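(* Let $F$ be a field, let $m$ be a natural number and let $\mathbf{m}=m^\infty$. The supernatural matrix algebra $\operatorname{M}_{\mathbf{m}}(F)$ is a homomorphic image of the algebra $\mathcal{E}^m_0$ of balanced deep matrices on $m$ letters.
   Context: $\operatorname{M}_{\mathbf{m}}(F)=\varinjlim_t\operatorname{M}_{m^t}(F)$ is the direct limit along the diagonal embeddings $x\mapsto x\otimes 1=\operatorname{diag}(x,\dots,x)$. An $\mathbf{m}$-adic word is a finite (possibly empty) word $u$ in the letters $\{0,\dots,m-1\}$; $|u|$ is its length. A word $u'$ is a tail of a word $w$ if $w=vu'$ for some word $v$. The algebra $\mathcal{E}^m$ of deep matrices on $m$ letters is the $F$-algebra generated by elements $d_{u,v}$, for arbitrary $\mathbf{m}$-adic words $u,v$ (of any lengths), subject to the multiplication rule $$d_{u,u'}d_{w,w'}=\begin{cases} d_{vu,w'} & \text{if } w=vu',\\ d_{u,vw'} & \text{if } u'=vw,\\ 0 & \text{if neither } u' \text{ nor } w \text{ is a tail of the other.}\end{cases}$$ Its unit is $d_{\emptyset,\emptyset}$. It is $\mathbb{Z}$-graded by $\deg(d_{u,v})=|u|-|v|$, and $\mathcal{E}^m_0$, the balanced deep matrix algebra, is the component of degree zero (generated by the $d_{u,v}$ with $|u|=|v|$). *)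

(* Defs.v *)
From HB Require Import structures.
From mathcomp Require Import all_boot all_order all_algebra generic_quotient.
From mathcomp Require Import ring boolp.

Set Implicit Arguments.
Unset Strict Implicit.
Unset Printing Implicit Defensive.

Import GRing.Theory.
Local Open Scope ring_scope.
Local Open Scope quotient_scope.

(* Word u' is a tail of w when [suffix u' w]; juxtaposition is [++]. *)
Definition word (m : nat) := seq 'I_m.

(* The deep matrix algebra is presented by the generators d_{u,v}: it is the  *)
(* quotient of the formal algebra expressions in the d_{u,v} by the least     *)
(* congruence containing the axioms of unital F-algebras, the relation        *)
(* d_{nil,nil} = 1 and the three cases of the multiplication rule.  DConst a  *)
(* stands for a times the unit, so scaling by a is multiplication by DConst a *)
(* and opposite is scaling by -1.  The axiom deq_mul0 is not redundant: with  *)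
(* no opposite among the operations, 0 x = 0 does not follow from the others. *)
Inductive deep_expr (F : Type) (m : nat) : Type :=
| DConst of F
| DGen of word m & word m
| DAdd of deep_expr F m & deep_expr F m
| DMul of deep_expr F m & deep_expr F m.

Arguments DConst {F m} a.
Arguments DGen {F m} u v.

Inductive deep_eq (F : fieldType) (m : nat) :
  deep_expr F m -> deep_expr F m -> Prop :=
| deq_refl x : deep_eq x x
| deq_sym x y : deep_eq x y -> deep_eq y x
| deq_trans x y z : deep_eq x y -> deep_eq y z -> deep_eq x z
| deq_add x x' y y' :
    deep_eq x x' -> deep_eq y y' -> deep_eq (DAdd x y) (DAdd x' y')
| deq_mul x x' y y' :
    deep_eq x x' -> deep_eq y y' -> deep_eq (DMul x y) (DMul x' y')
| deq_addA x y z : deep_eq (DAdd x (DAdd y z)) (DAdd (DAdd x y) z)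
| deq_addC x y : deep_eq (DAdd x y) (DAdd y x)
| deq_add0 x : deep_eq (DAdd (DConst 0) x) x
| deq_mulA x y z : deep_eq (DMul x (DMul y z)) (DMul (DMul x y) z)
| deq_mul1 x : deep_eq (DMul (DConst 1) x) x
| deq_mulDl x y z : deep_eq (DMul (DAdd x y) z) (DAdd (DMul x z) (DMul y z))
| deq_mulDr x y z : deep_eq (DMul x (DAdd y z)) (DAdd (DMul x y) (DMul x z))
| deq_mul0 x : deep_eq (DMul (DConst 0) x) (DConst 0)
| deq_constD a b : deep_eq (DAdd (DConst a) (DConst b)) (DConst (a + b))
| deq_constM a b : deep_eq (DMul (DConst a) (DConst b)) (DConst (a * b))
| deq_constC a x : deep_eq (DMul (DConst a) x) (DMul x (DConst a))
| deq_unit : deep_eq (DGen [::] [::]) (DConst 1)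
| deq_tail_l u u' v w' :
    deep_eq (DMul (DGen u u') (DGen (v ++ u') w')) (DGen (v ++ u) w')
| deq_tail_r u v w w' :
    deep_eq (DMul (DGen u (v ++ w)) (DGen w w')) (DGen u (v ++ w'))
| deq_tail_none u u' w w' : ~~ suffix u' w -> ~~ suffix w u' ->
    deep_eq (DMul (DGen u u') (DGen w w')) (DConst 0).

#[export] Hint Resolve deq_refl : core.

HB.instance Definition _ (F : Type) m := gen_eqMixin (deep_expr F m).
HB.instance Definition _ (F : Type) m := gen_choiceMixin (deep_expr F m).

Section DeepAlgebra.
Variables (F : fieldType) (m : nat).
Local Notation expr := (deep_expr F m).

Definition deep_eqb (x y : expr) : bool := `[< deep_eq x y >].

Lemma deep_eqb_refl : reflexive deep_eqb.
Proof. by move=> x; apply/asboolP. Qed.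

Lemma deep_eqb_sym : symmetric deep_eqb.
Proof. by move=> x y; apply/asboolP/asboolP; apply: deq_sym. Qed.

Lemma deep_eqb_trans : transitive deep_eqb.
Proof.
by move=> y x z /asboolP xy /asboolP yz; apply/asboolP; apply: deq_trans yz.
Qed.

Canonical deep_equiv := EquivRel deep_eqb deep_eqb_refl deep_eqb_sym
  deep_eqb_trans.

Definition deep := {eq_quot deep_equiv}.
HB.instance Definition _ := Choice.on deep.
HB.instance Definition _ := EqQuotient.on deep.

Lemma deep_eqP (x y : expr) :
  deep_eq x y <-> \pi_deep x = \pi_deep y.
Proof.
split=> [xy|/eqmodP/asboolP//].
by apply/eqmodP; apply/asboolP.
Qed.

Lemma deep_reprP (x : expr) : deep_eq (repr (\pi_deep x)) x.
Proof. by apply/deep_eqP; rewrite reprK. Qed.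

Definition deep_add (x y : deep) : deep := \pi_deep (DAdd (repr x) (repr y)).
Definition deep_mul (x y : deep) : deep := \pi_deep (DMul (repr x) (repr y)).
Definition deep_const (a : F) : deep := \pi_deep (DConst a).

Lemma pi_deep_add x y : deep_add (\pi x) (\pi y) = \pi_deep (DAdd x y).
Proof. by apply/deep_eqP; apply: deq_add; apply: deep_reprP. Qed.

Lemma pi_deep_mul x y : deep_mul (\pi x) (\pi y) = \pi_deep (DMul x y).
Proof. by apply/deep_eqP; apply: deq_mul; apply: deep_reprP. Qed.

Let pi_deepE := (pi_deep_add, pi_deep_mul).

Lemma deep_addA : associative deep_add.
Proof.
elim/quotW=> x; elim/quotW=> y; elim/quotW=> z; rewrite !pi_deepE.
by apply/deep_eqP; apply: deq_addA.
Qed.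

Lemma deep_addC : commutative deep_add.
Proof.
elim/quotW=> x; elim/quotW=> y; rewrite !pi_deepE.
by apply/deep_eqP; apply: deq_addC.
Qed.

Lemma deep_add0 : left_id (deep_const 0) deep_add.
Proof.
elim/quotW=> x; rewrite !pi_deepE.
by apply/deep_eqP; apply: deq_add0.
Qed.

Lemma deep_mulA : associative deep_mul.
Proof.
elim/quotW=> x; elim/quotW=> y; elim/quotW=> z; rewrite !pi_deepE.
by apply/deep_eqP; apply: deq_mulA.
Qed.

Lemma deep_mul1 : left_id (deep_const 1) deep_mul.
Proof.
elim/quotW=> x; rewrite !pi_deepE.
by apply/deep_eqP; apply: deq_mul1.
Qed.

Lemma deep_mulDl : left_distributive deep_mul deep_add.
Proof.
elim/quotW=> x; elim/quotW=> y; elim/quotW=> z; rewrite !pi_deepE.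
by apply/deep_eqP; apply: deq_mulDl.
Qed.

Lemma deep_mulDr : right_distributive deep_mul deep_add.
Proof.
elim/quotW=> x; elim/quotW=> y; elim/quotW=> z; rewrite !pi_deepE.
by apply/deep_eqP; apply: deq_mulDr.
Qed.

Lemma deep_constD a b : deep_add (deep_const a) (deep_const b) =
  deep_const (a + b).
Proof.
by rewrite !pi_deepE; apply/deep_eqP; apply: deq_constD.
Qed.

Lemma deep_constM a b : deep_mul (deep_const a) (deep_const b) =
  deep_const (a * b).
Proof.
by rewrite !pi_deepE; apply/deep_eqP; apply: deq_constM.
Qed.

Lemma deep_constC a x : deep_mul (deep_const a) x = deep_mul x (deep_const a).
Proof.
elim/quotW: x => x; rewrite !pi_deepE.
by apply/deep_eqP; apply: deq_constC.
Qed.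

Lemma deep_mulr1 : right_id (deep_const 1) deep_mul.
Proof. by move=> x; rewrite -deep_constC deep_mul1. Qed.

Definition deep_opp (x : deep) : deep := deep_mul (deep_const (-1)) x.

Lemma deep_addN : left_inverse (deep_const 0) deep_opp deep_add.
Proof.
move=> x; rewrite /deep_opp -{2}[x]deep_mul1 -deep_mulDl deep_constD addNr.
by elim/quotW: x => x; rewrite !pi_deepE; apply/deep_eqP; apply: deq_mul0.
Qed.

HB.instance Definition _ :=
  GRing.isZmodule.Build deep deep_addA deep_addC deep_add0 deep_addN.

(* Only pzRingType is used, so that no case has to be excluded: for m = 0 the *)
(* direct limit below is the zero ring.  Hence [algType] is not available and *)
(* compatibility of products with scaling is stated as scalerAl and scalerAr. *)
HB.instance Definition _ := GRing.Zmodule_isPzRing.Build deep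
  deep_mulA deep_mul1 deep_mulr1 deep_mulDl deep_mulDr.

Definition deep_scale (a : F) (x : deep) : deep := deep_const a * x.

Lemma deep_scaleA a b x : deep_scale a (deep_scale b x) = deep_scale (a * b) x.
Proof. by rewrite /deep_scale mulrA -deep_constM. Qed.

Lemma deep_scale1 : left_id 1 deep_scale.
Proof. by move=> x; rewrite /deep_scale mul1r. Qed.

Lemma deep_scaleDr : right_distributive deep_scale +%R.
Proof. by move=> a x y; rewrite /deep_scale mulrDr. Qed.

Lemma deep_scaleDl x : {morph deep_scale^~ x : a b / a + b}.
Proof. by move=> a b; rewrite /deep_scale -mulrDl -deep_constD. Qed.

HB.instance Definition _ := GRing.Zmodule_isLmodule.Build F deep
  deep_scaleA deep_scale1 deep_scaleDr deep_scaleDl.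

Lemma deep_scalerAl (a : F) (x y : deep) : a *: (x * y) = (a *: x) * y.
Proof. exact: mulrA. Qed.

Lemma deep_scalerAr (a : F) (x y : deep) : a *: (x * y) = x * (a *: y).
Proof.
rewrite /GRing.scale /= /deep_scale !mulrA; congr (_ * y).
exact: deep_constC.
Qed.

Definition dgen (u v : word m) : deep := \pi_deep (DGen u v).

Lemma dgen_unit : dgen [::] [::] = 1.
Proof. by apply/deep_eqP; apply: deq_unit. Qed.

Lemma dgen_tail_l u u' v w' : dgen u u' * dgen (v ++ u') w' = dgen (v ++ u) w'.
Proof. by rewrite [LHS]pi_deep_mul; apply/deep_eqP; apply: deq_tail_l. Qed.

Lemma dgen_tail_r u v w w' : dgen u (v ++ w) * dgen w w' = dgen u (v ++ w').
Proof. by rewrite [LHS]pi_deep_mul; apply/deep_eqP; apply: deq_tail_r. Qed.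

Lemma dgen_tail_none u u' w w' : ~~ suffix u' w -> ~~ suffix w u' ->
  dgen u u' * dgen w w' = 0.
Proof.
move=> u'w wu'; rewrite [LHS]pi_deep_mul; apply/deep_eqP.
exact: deq_tail_none.
Qed.

(* The component of degree k is the F-span of the d_{u,v} of degree k. *)
Definition deep_deg (uv : word m * word m) : int :=
  (size uv.1)%:Z - (size uv.2)%:Z.

Definition deep_component (k : int) : {pred deep} := fun x =>
  `[< exists2 s : seq (F * (word m * word m)), all (fun p => deep_deg p.2 == k) s &
      x = \sum_(p <- s) p.1 *: dgen p.2.1 p.2.2 >].

Lemma deep_component_span k x : reflect
  (exists2 s : seq (F * (word m * word m)), all (fun p => deep_deg p.2 == k) s &
      x = \sum_(p <- s) p.1 *: dgen p.2.1 p.2.2) (x \in deep_component k).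
Proof. exact: asboolP. Qed.

Lemma deep_component_d u v k : deep_deg (u, v) = k -> dgen u v \in deep_component k.
Proof.
move=> duv; apply/deep_component_span; exists [:: (1, (u, v))].
  by rewrite /= duv eqxx.
by rewrite big_seq1 scale1r.
Qed.

Lemma deep_component0 k : 0 \in deep_component k.
Proof. by apply/deep_component_span; exists [::]; rewrite ?big_nil. Qed.

Lemma deep_componentD k :
  {in deep_component k &, forall x y, x + y \in deep_component k}.
Proof.
move=> x y /deep_component_span[s sk ->] /deep_component_span[t tk ->].
by apply/deep_component_span; exists (s ++ t); rewrite ?all_cat ?sk // big_cat.
Qed.

Lemma deep_componentZ k a :
  {in deep_component k, forall x, a *: x \in deep_component k}.
Proof.
move=> x /deep_component_span[s sk ->]; apply/deep_component_span.
exists [seq (a * p.1, p.2) | p <- s]; first by rewrite all_map.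
by rewrite big_map scaler_sumr; apply: eq_bigr => p _; rewrite scalerA.
Qed.

Lemma deep_component_sum k (I : Type) (r : seq I) (P : pred I) (f : I -> deep) :
  (forall i, P i -> f i \in deep_component k) ->
  \sum_(i <- r | P i) f i \in deep_component k.
Proof.
move=> fk; elim/big_rec: _ => [|i x Pi xk]; first exact: deep_component0.
by apply: deep_componentD => //; apply: fk.
Qed.

Lemma deep_component_dM k l u u' w w' : deep_deg (u, u') = k -> deep_deg (w, w') = l ->
  dgen u u' * dgen w w' \in deep_component (k + l).
Proof.
move=> <- <-; have [/suffixP[v ->]|u'w] := boolP (suffix u' w).
  rewrite dgen_tail_l; apply: deep_component_d.
  by rewrite /deep_deg /= !size_cat !PoszD addrA addrCA !addrA; ring.
have [/suffixP[v ->]|wu'] := boolP (suffix w u').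
  rewrite dgen_tail_r; apply: deep_component_d.
  by rewrite /deep_deg /= !size_cat !PoszD; ring.
by rewrite dgen_tail_none //; apply: deep_component0.
Qed.

Lemma deep_componentM k l x y :
  x \in deep_component k -> y \in deep_component l ->
  x * y \in deep_component (k + l).
Proof.
move=> /deep_component_span[s /allP sk ->] /deep_component_span[t /allP tl ->].
rewrite mulr_suml big_seq; apply: deep_component_sum => p /sk /eqP pk.
rewrite mulr_sumr big_seq; apply: deep_component_sum => q /tl /eqP ql.
rewrite -deep_scalerAl -deep_scalerAr; do 2 apply: deep_componentZ.
by apply: deep_component_dM; rewrite -surjective_pairing.
Qed.

Lemma deep_component0_subring : subring_closed (deep_component 0).
Proof.
split.
- by rewrite -dgen_unit; apply: deep_component_d.
- move=> x y x0 y0; apply: deep_componentD => //; rewrite -scaleN1r.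
  exact: deep_componentZ.
- by move=> x y x0 y0; rewrite -[0]addr0; apply: deep_componentM.
Qed.

Lemma deep_component0_submod : subsemimod_closed (deep_component 0).
Proof.
split; first by split; [exact: deep_component0|exact: deep_componentD].
by move=> a x; apply: deep_componentZ.
Qed.

Record balanced_deep := BalancedDeep {
  balanced_deep_val :> deep;
  _ : balanced_deep_val \in deep_component 0 }.

HB.instance Definition _ := [isSub for balanced_deep_val].
HB.instance Definition _ := [Choice of balanced_deep by <:].
HB.instance Definition _ :=
  GRing.SubChoice_isSubPzRing.Build deep (deep_component 0) balanced_deep
    deep_component0_subring.
HB.instance Definition _ :=
  GRing.SubZmodule_isSubLmodule.Build F deep (deep_component 0) balanced_deep
    deep_component0_submod.

Lemma balanced_deep_scalerAl (a : F) (x y : balanced_deep) : a *: (x * y) = (a *: x) * y.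
Proof. by apply: val_inj; rewrite !(rmorphM, linearZ) /= deep_scalerAl. Qed.

Lemma balanced_deep_scalerAr (a : F) (x y : balanced_deep) : a *: (x * y) = x * (a *: y).
Proof. by apply: val_inj; rewrite !(rmorphM, linearZ) /= deep_scalerAr. Qed.

End DeepAlgebra.

Section Supernatural.
Variables (F : fieldType) (m : nat).

Lemma sum_expn t : (\sum_(i < m) m ^ t = m ^ t.+1)%N.
Proof. by rewrite sum_nat_const card_ord expnS. Qed.

(* M_{m^t} -> M_{m^(t+1)}, x |-> diag(x, ..., x) with m diagonal blocks. *)
Definition diag_emb t (x : 'M[F]_(m ^ t)) : 'M[F]_(m ^ t.+1) :=
  castmx (sum_expn t, sum_expn t) (\mxdiag_(i < m) x).

Lemma diag_embD t : {morph @diag_emb t : x y / x + y}.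
Proof.
move=> x y; rewrite /diag_emb mxdiagD; case: _ / (sum_expn t).
by rewrite !castmx_id.
Qed.

Lemma diag_embM t : {morph @diag_emb t : x y / x *m y}.
Proof.
move=> x y; rewrite /diag_emb; case: _ / (sum_expn t); rewrite !castmx_id.
rewrite [X in _ = _ *m X]/mxdiag mul_mxdiag_mxblock; apply: eq_mxblock => i j.
by case: eqP; rewrite ?conform_mx_id ?mulmx0.
Qed.

Lemma diag_emb1 t : @diag_emb t 1%:M = 1%:M.
Proof.
rewrite /diag_emb mxdiagZ; case: _ / (sum_expn t).
by rewrite castmx_id.
Qed.

Lemma diag_embZ t a : {morph @diag_emb t : x / a *: x}.
Proof.
move=> x; rewrite -!mul_scalar_mx diag_embM; congr (_ *m _).
rewrite /diag_emb mxdiagZ; case: _ / (sum_expn t).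
by rewrite castmx_id.
Qed.

Lemma diag_emb0 t : @diag_emb t 0 = 0.
Proof. by rewrite -(scale0r 0) diag_embZ scale0r. Qed.

Local Notation M t := 'M[F]_(m ^ t).
Local Notation Lvl t x := (Tagged (fun k => M k) (x : M t)).

(* A matrix x of size m^t is recorded as the dependent pair of t and x. *)
Definition level_mx := {t : nat & M t}.

Definition level_emb (p : level_mx) : level_mx :=
  Tagged (fun t => M t) (diag_emb (tagged p)).

(* The image of p at level n; meaningful only for tag p <= n. *)
Definition at_level n (p : level_mx) : M n :=
  tagged_as (Lvl n 0) (iter (n - tag p) level_emb p).

Lemma at_levelE n p : (tag p <= n)%N ->
  Lvl n (at_level n p) = iter (n - tag p) level_emb p.
Proof.
move=> pn; rewrite /at_level.
have: tag (iter (n - tag p) level_emb p) = n.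
  by rewrite -[RHS](subnK pn); elim: (n - tag p)%N => //= k ->.
by case: (iter _ _ _) => k x /= kn; case: _ / kn; rewrite tagged_asE.
Qed.

Lemma at_level_tag t (x : M t) : at_level t (Lvl t x) = x.
Proof. by rewrite /at_level subnn /= tagged_asE. Qed.

Lemma at_levelS n p : (tag p <= n)%N ->
  at_level n.+1 p = diag_emb (at_level n p).
Proof.
move=> pn; apply: (@eq_from_Tagged _ (fun t => M t)).
by rewrite at_levelE ?leqW // subSn //= -at_levelE.
Qed.

(* Two matrices are identified when their images at some common level agree. *)
Definition level_eq (p q : level_mx) : bool :=
  `[< exists n, [/\ tag p <= n, tag q <= n & at_level n p = at_level n q]%N >].

Lemma at_level_le k n p q : (tag p <= n)%N -> (tag q <= n)%N -> (n <= k)%N ->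
  at_level n p = at_level n q -> at_level k p = at_level k q.
Proof.
move=> pn qn /subnK<-; elim: (k - n)%N => //= j IH /IH epq.
by rewrite addSn !at_levelS ?epq // (leq_trans _ (leq_addl _ _)).
Qed.

Lemma level_eq_refl : reflexive level_eq.
Proof. by move=> p; apply/asboolP; exists (tag p). Qed.

Lemma level_eq_sym : symmetric level_eq.
Proof.
by move=> p q; apply/asboolP/asboolP => -[n [? ? ?]]; exists n; split.
Qed.

Lemma level_eq_trans : transitive level_eq.
Proof.
move=> q p r /asboolP[n [pn qn pq]] /asboolP[k [qk rk qr]].
apply/asboolP; exists (maxn n k); split.
- by rewrite leq_max pn.
- by rewrite leq_max rk orbT.
- rewrite (at_level_le pn qn _ pq) ?leq_maxl //.
  by rewrite (at_level_le qk rk _ qr) ?leq_maxr.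
Qed.

Canonical level_equiv := EquivRel level_eq level_eq_refl level_eq_sym
  level_eq_trans.

Definition supernatural_mx := {eq_quot level_equiv}.
HB.instance Definition _ := Choice.on supernatural_mx.
HB.instance Definition _ := EqQuotient.on supernatural_mx.

Lemma supernatural_mx_eqP (p q : level_mx) :
  (exists n, [/\ tag p <= n, tag q <= n & at_level n p = at_level n q]%N) <->
  \pi_supernatural_mx p = \pi_supernatural_mx q.
Proof.
split=> [pq|/eqmodP/asboolP//].
by apply/eqmodP; apply/asboolP.
Qed.

Definition supernatural_mx_of t (x : M t) : supernatural_mx := \pi_supernatural_mx (Lvl t x).

Definition level_op (f : forall n, M n -> M n -> M n) (p q : level_mx) :=
  let n := maxn (tag p) (tag q) in Lvl n (f n (at_level n p) (at_level n q)).

Lemma supernatural_mx_of_level n p : (tag p <= n)%N ->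
  supernatural_mx_of (at_level n p) = \pi p.
Proof.
move=> pn; apply/supernatural_mx_eqP; exists n; split=> //.
by rewrite at_level_tag.
Qed.

Lemma supernatural_mx_of_emb t (x : M t) : supernatural_mx_of (diag_emb x) = supernatural_mx_of x.
Proof.
rewrite -[RHS](@supernatural_mx_of_level t.+1) //=.
by rewrite at_levelS // at_level_tag.
Qed.

Lemma supernatural_mx_common2 (x y : supernatural_mx) :
  exists t (a b : M t), x = supernatural_mx_of a /\ y = supernatural_mx_of b.
Proof.
elim/quotW: x => p; elim/quotW: y => q; set t := maxn (tag p) (tag q).
exists t, (at_level t p), (at_level t q).
by rewrite !supernatural_mx_of_level // ?leq_maxl ?leq_maxr.
Qed.

Lemma supernatural_mx_common3 (x y z : supernatural_mx) : exists t (a b c : M t),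
  [/\ x = supernatural_mx_of a, y = supernatural_mx_of b & z = supernatural_mx_of c].
Proof.
elim/quotW: x => p; elim/quotW: y => q; elim/quotW: z => r.
set t := maxn (maxn (tag p) (tag q)) (tag r).
exists t, (at_level t p), (at_level t q), (at_level t r).
by rewrite !supernatural_mx_of_level // !leq_max leqnn ?orbT.
Qed.

Lemma supernatural_mx_common1 (x : supernatural_mx) : exists t (a : M t), x = supernatural_mx_of a.
Proof. by have [t [a [_ [-> _]]]] := supernatural_mx_common2 x x; exists t, a. Qed.

Definition supernatural_mx_add (x y : supernatural_mx) : supernatural_mx :=
  \pi_supernatural_mx (level_op (fun n => +%R) (repr x) (repr y)).
Definition supernatural_mx_mul (x y : supernatural_mx) : supernatural_mx :=
  \pi_supernatural_mx (level_op (fun n => mulmx) (repr x) (repr y)).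
Definition supernatural_mx_scale (a : F) (x : supernatural_mx) : supernatural_mx :=
  supernatural_mx_of (a *: tagged (repr x)).
Definition supernatural_mx_opp (x : supernatural_mx) : supernatural_mx :=
  supernatural_mx_of (- tagged (repr x)).

Lemma supernatural_mx_ofP t (x : M t) : exists n, [/\ (tag (repr (supernatural_mx_of x)) <= n)%N,
   (t <= n)%N & at_level n (repr (supernatural_mx_of x)) = at_level n (Lvl t x)].
Proof. by apply/(supernatural_mx_eqP _ (Lvl t x)); rewrite reprK. Qed.

Lemma supernatural_mx_op_of (f : forall n, M n -> M n -> M n)
    (fM : forall n, {morph @diag_emb n : x y / f n x y >-> f n.+1 x y}) t (x y : M t) :
  \pi_supernatural_mx (level_op f (repr (supernatural_mx_of x)) (repr (supernatural_mx_of y))) =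
  supernatural_mx_of (f t x y).
Proof.
have level_f k n (p q : level_mx) : (maxn (tag p) (tag q) <= k)%N -> (k <= n)%N ->
    at_level n (Lvl k (f k (at_level k p) (at_level k q))) =
    f n (at_level n p) (at_level n q).
  rewrite geq_max => /andP[pk qk] /subnK<-.
  elim: (n - k)%N => [|j IH]; first by rewrite add0n at_level_tag.
  have kj : (k <= j + k)%N := leq_addl j k.
  by rewrite addSn !at_levelS ?IH ?fM //= (leq_trans _ kj).
have [n1 [p1 t1 e1]] := supernatural_mx_ofP x; have [n2 [p2 t2 e2]] := supernatural_mx_ofP y.
move: (repr (supernatural_mx_of x)) (repr (supernatural_mx_of y)) p1 p2 e1 e2.
move=> p q p1 q2 e1 e2; pose n := maxn n1 n2; have [n1n n2n] : (n1 <= n)%N /\ (n2 <= n)%N.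
  by rewrite leq_maxl leq_maxr.
have pqn : (maxn (tag p) (tag q) <= n)%N.
  by rewrite geq_max (leq_trans p1) // (leq_trans q2).
have tn := leq_trans t1 n1n.
apply/(supernatural_mx_eqP (level_op f p q)); exists n; split=> //; rewrite level_f //.
have -> : f t x y = f t (at_level t (Lvl t x)) (at_level t (Lvl t y)).
  by rewrite !at_level_tag.
rewrite level_f ?maxnn //=.
rewrite (@at_level_le n n1 p (Lvl t x)) //.
by rewrite (@at_level_le n n2 q (Lvl t y)).
Qed.

Lemma supernatural_mx_ofD t (x y : M t) :
  supernatural_mx_add (supernatural_mx_of x) (supernatural_mx_of y) = supernatural_mx_of (x + y).
Proof. exact: (supernatural_mx_op_of (fun n => @diag_embD n)). Qed.

Lemma supernatural_mx_ofM t (x y : M t) :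
  supernatural_mx_mul (supernatural_mx_of x) (supernatural_mx_of y) = supernatural_mx_of (x *m y).
Proof. exact: (supernatural_mx_op_of (fun n => @diag_embM n)). Qed.

Lemma supernatural_mx_ofZ a t (x : M t) :
  supernatural_mx_scale a (supernatural_mx_of x) = supernatural_mx_of (a *: x).
Proof.
have levelZ n p : (tag p <= n)%N ->
    at_level n (Lvl (tag p) (a *: tagged p)) = a *: at_level n p.
  case: p => k p /= /subnK<-; elim: (n - k)%N => [|j IH].
    by rewrite add0n !at_level_tag.
  have kj : (k <= j + k)%N := leq_addl j k.
  by rewrite addSn !at_levelS ?IH ?diag_embZ.
have [n [pn tn e]] := supernatural_mx_ofP x; apply/supernatural_mx_eqP; exists n; split=> //.
by rewrite levelZ // e -(levelZ n (Lvl t x)).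
Qed.

Lemma supernatural_mx_ofN t (x : M t) : supernatural_mx_opp (supernatural_mx_of x) = supernatural_mx_of (- x).
Proof.
rewrite -scaleN1r -supernatural_mx_ofZ /supernatural_mx_opp /supernatural_mx_scale.
by rewrite scaleN1r.
Qed.

Definition supernatural_mx0 : supernatural_mx := supernatural_mx_of (0 : M 0).
Definition supernatural_mx1 : supernatural_mx := supernatural_mx_of (1%:M : M 0).

Lemma supernatural_mx_of0 t : supernatural_mx_of (0 : M t) = supernatural_mx0.
Proof.
by elim: t => // t <-; rewrite -diag_emb0 supernatural_mx_of_emb.
Qed.

Lemma supernatural_mx_of1 t : supernatural_mx_of (1%:M : M t) = supernatural_mx1.
Proof. by elim: t => // t <-; rewrite -diag_emb1 supernatural_mx_of_emb. Qed.

Let supE := (supernatural_mx_ofD, supernatural_mx_ofM, supernatural_mx_ofZ, supernatural_mx_ofN).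

Lemma supernatural_mx_addA : associative supernatural_mx_add.
Proof.
move=> x y z; have [t [a [b [c [-> -> ->]]]]] := supernatural_mx_common3 x y z.
by rewrite !supE addrA.
Qed.

Lemma supernatural_mx_addC : commutative supernatural_mx_add.
Proof.
move=> x y; have [t [a [b [-> ->]]]] := supernatural_mx_common2 x y.
by rewrite !supE addrC.
Qed.

Lemma supernatural_mx_add0 : left_id supernatural_mx0 supernatural_mx_add.
Proof.
move=> x; have [t [a ->]] := supernatural_mx_common1 x.
by rewrite -(supernatural_mx_of0 t) supE add0r.
Qed.

Lemma supernatural_mx_addN : left_inverse supernatural_mx0 supernatural_mx_opp supernatural_mx_add.
Proof.
move=> x; have [t [a ->]] := supernatural_mx_common1 x.
by rewrite !supE addNr supernatural_mx_of0.
Qed.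

HB.instance Definition _ := GRing.isZmodule.Build supernatural_mx
  supernatural_mx_addA supernatural_mx_addC supernatural_mx_add0 supernatural_mx_addN.

Lemma supernatural_mx_mulA : associative supernatural_mx_mul.
Proof.
move=> x y z; have [t [a [b [c [-> -> ->]]]]] := supernatural_mx_common3 x y z.
by rewrite !supE mulmxA.
Qed.

Lemma supernatural_mx_mul1 : left_id supernatural_mx1 supernatural_mx_mul.
Proof.
move=> x; have [t [a ->]] := supernatural_mx_common1 x.
by rewrite -(supernatural_mx_of1 t) supE mul1mx.
Qed.

Lemma supernatural_mx_mulr1 : right_id supernatural_mx1 supernatural_mx_mul.
Proof.
move=> x; have [t [a ->]] := supernatural_mx_common1 x.
by rewrite -(supernatural_mx_of1 t) supE mulmx1.
Qed.

Lemma supernatural_mx_mulDl : left_distributive supernatural_mx_mul +%R.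
Proof.
move=> x y z; have [t [a [b [c [-> -> ->]]]]] := supernatural_mx_common3 x y z.
by rewrite /GRing.add /= !supE mulmxDl.
Qed.

Lemma supernatural_mx_mulDr : right_distributive supernatural_mx_mul +%R.
Proof.
move=> x y z; have [t [a [b [c [-> -> ->]]]]] := supernatural_mx_common3 x y z.
by rewrite /GRing.add /= !supE mulmxDr.
Qed.

HB.instance Definition _ := GRing.Zmodule_isPzRing.Build supernatural_mx
  supernatural_mx_mulA supernatural_mx_mul1 supernatural_mx_mulr1 supernatural_mx_mulDl supernatural_mx_mulDr.

Lemma supernatural_mx_scaleA a b x :
  supernatural_mx_scale a (supernatural_mx_scale b x) = supernatural_mx_scale (a * b) x.
Proof.
by have [t [c ->]] := supernatural_mx_common1 x; rewrite !supE scalerA.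
Qed.

Lemma supernatural_mx_scale1 : left_id 1 supernatural_mx_scale.
Proof.
by move=> x; have [t [c ->]] := supernatural_mx_common1 x; rewrite !supE scale1r.
Qed.

Lemma supernatural_mx_scaleDr : right_distributive supernatural_mx_scale +%R.
Proof.
move=> a x y; have [t [b [c [-> ->]]]] := supernatural_mx_common2 x y.
by rewrite /GRing.add /= !supE scalerDr.
Qed.

Lemma supernatural_mx_scaleDl x : {morph supernatural_mx_scale^~ x : a b / a + b}.
Proof.
move=> a b; have [t [c ->]] := supernatural_mx_common1 x.
by rewrite [in RHS]/GRing.add /= !supE scalerDl.
Qed.

HB.instance Definition _ := GRing.Zmodule_isLmodule.Build F supernatural_mx
  supernatural_mx_scaleA supernatural_mx_scale1 supernatural_mx_scaleDr supernatural_mx_scaleDl.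

Lemma supernatural_mx_scalerAl (a : F) (x y : supernatural_mx) : a *: (x * y) = (a *: x) * y.
Proof.
have [t [b [c [-> ->]]]] := supernatural_mx_common2 x y.
by rewrite /GRing.scale /GRing.mul /= !supE scalemxAl.
Qed.

Lemma supernatural_mx_scalerAr (a : F) (x y : supernatural_mx) : a *: (x * y) = x * (a *: y).
Proof.
have [t [b [c [-> ->]]]] := supernatural_mx_common2 x y.
by rewrite /GRing.scale /GRing.mul /= !supE scalemxAr.
Qed.

End Supernatural.

(* Main.v *)
Require Import Defs.
From HB Require Import structures.
From mathcomp Require Import all_boot all_order all_algebra generic_quotient.
From mathcomp Require Import boolp.

Set Implicit Arguments.
Unset Strict Implicit.
Unset Printing Implicit Defensive.

Import GRing.Theory.
Local Open Scope ring_scope.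
Local Open Scope quotient_scope.

(* Let the deep matrix algebra act on F-valued functions phi on finite words   *)
(* by (d_{u,v} phi)(y u) = phi(y v), and (d_{u,v} phi)(x) = 0 when u is not a  *)
(* tail of x.  A balanced element preserves the length of words, so it gives a *)
(* matrix on the words of each length n, multiplicatively in the element.  For *)
(* n at least the lengths of all words involved, passing from n to n + 1 only  *)
(* lets the first letter through, i.e. is the diagonal embedding: the matrices *)
(* of large level define one element of the direct limit.  Matrix units of     *)
(* level t come from the d_{u,v} with |u| = |v| = t, whence surjectivity.      *)

(** A presented algebra maps to operators as soon as its relations hold there: [expr_act_eq] checks
    them for tail replacement on functions on words, which gives the action [deep_act]. By
    [deep_act_mx] a degree zero element acts on words of length n through its level n matrix alone,
    hence multiplicativity ([deep_mxM]). By [stable_from_dgen] these matrices are eventually related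
    by the diagonal embedding, so their class in the limit is eventually constant; this is
    [balanced_map]. Surjectivity comes from the matrix units of [deep_mx_dgen]. *)

Lemma suffix_total (T : eqType) (s t r : seq T) :
  suffix s r -> suffix t r -> suffix s t || suffix t s.
Proof.
wlog st : s t / (size s <= size t)%N => [IH sr tr|sr /suffixP[p rE]].
  have [st|/ltnW ts] := leqP (size s) (size t); first exact: IH.
  by rewrite orbC IH.
move: sr; rewrite rE !suffixE size_cat -addnBA // drop_cat ltnNge leq_addr /=.
by rewrite addKn => ->.
Qed.

(** * The action on functions on words *)

Section Action.
Variables (F : fieldType) (m : nat).
Implicit Types (u v w : word m) (phi psi : word m -> F).

Definition gen_act u v phi : word m -> F := fun w =>
  if suffix u w then phi (take (size w - size u) w ++ v) else 0.

Lemma gen_act_cat u v phi w : gen_act u v phi (w ++ u) = phi (w ++ v).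
Proof. by rewrite /gen_act suffix_suffix size_cat addnK take_size_cat. Qed.

Lemma gen_act_none u v phi w : ~~ suffix u w -> gen_act u v phi w = 0.
Proof. by rewrite /gen_act => /negPf->. Qed.

Lemma gen_act_tail_l u u' v w' phi :
  gen_act u u' (gen_act (v ++ u') w' phi) = gen_act (v ++ u) w' phi.
Proof.
apply/funext => x.
have [/suffixP[y ->]|Nx] := boolP (suffix (v ++ u) x).
  by rewrite gen_act_cat catA gen_act_cat -catA gen_act_cat.
rewrite [RHS]gen_act_none //.
have [/suffixP[y xE]|Nu] := boolP (suffix u x); last exact: gen_act_none.
rewrite xE gen_act_cat gen_act_none //.
(* Both tail conditions reduce to [v] being a tail of [y]. *)
by move: Nx; rewrite xE !suffix_catl // !eqxx.
Qed.

Lemma gen_act_tail_r u v w w' phi :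
  gen_act u (v ++ w) (gen_act w w' phi) = gen_act u (v ++ w') phi.
Proof.
apply/funext => x.
have [/suffixP[y ->]|Nx] := boolP (suffix u x); last by rewrite !gen_act_none.
by rewrite !gen_act_cat catA gen_act_cat -catA.
Qed.

(** A nonzero value needs a word [y ++ u'] ending in [w]; two tails of one word are comparable,
    which is excluded here. *)
Lemma gen_act_tail_none u u' w w' phi : ~~ suffix u' w -> ~~ suffix w u' ->
  gen_act u u' (gen_act w w' phi) = fun=> 0.
Proof.
move=> u'w wu'; apply/funext => x.
have [/suffixP[y ->]|Nx] := boolP (suffix u x); last by rewrite !gen_act_none.
rewrite gen_act_cat gen_act_none //; apply/negP => wy.
by have := suffix_total wy (suffix_suffix y u'); rewrite (negPf wu') (negPf u'w).
Qed.

Fixpoint expr_act (e : deep_expr F m) phi : word m -> F :=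
  match e with
  | DConst a => fun w => a * phi w
  | DGen u v => gen_act u v phi
  | DAdd x y => fun w => expr_act x phi w + expr_act y phi w
  | DMul x y => expr_act x (expr_act y phi)
  end.

(** Additivity is what makes the operators satisfy [deq_mulDr]; homogeneity, proved next, gives
    [deq_constC]. *)
Lemma expr_actD e phi psi :
  expr_act e (fun w => phi w + psi w) =
  fun w => expr_act e phi w + expr_act e psi w.
Proof.
elim: e phi psi => [a|u v|x IHx y IHy|x IHx y IHy] phi psi /=.
- by apply/funext => w; rewrite mulrDr.
- by apply/funext => w; rewrite /gen_act; case: ifP; rewrite ?addr0.
- by apply/funext => w; rewrite IHx IHy addrACA.
- by rewrite IHy IHx.
Qed.

Lemma expr_actZ e a phi :
  expr_act e (fun w => a * phi w) = fun w => a * expr_act e phi w.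
Proof.
elim: e phi => [b|u v|x IHx y IHy|x IHx y IHy] phi /=.
- by apply/funext => w; rewrite mulrCA.
- by apply/funext => w; rewrite /gen_act; case: ifP; rewrite ?mulr0.
- by apply/funext => w; rewrite IHx IHy mulrDr.
- by rewrite IHy IHx.
Qed.

Lemma expr_act_eq e e' : deep_eq e e' -> expr_act e = expr_act e'.
Proof.
elim=> {e e'} //=.
- by move=> x y z _ -> _ ->.
- by move=> x x' y y' _ -> _ ->.
- by move=> x x' y y' _ -> _ ->.
- by move=> x y z; apply/funext => phi; apply/funext => w; rewrite addrA.
- by move=> x y; apply/funext => phi; apply/funext => w; rewrite addrC.
- by move=> x; apply/funext => phi; apply/funext => w; rewrite mul0r add0r.
- by move=> x; apply/funext => phi; apply/funext => w; rewrite mul1r.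
- by move=> x y z; apply/funext => phi; rewrite expr_actD.
- by move=> x; apply/funext => phi; apply/funext => w; rewrite !mul0r.
- by move=> a b; apply/funext => phi; apply/funext => w; rewrite mulrDl.
- by move=> a b; apply/funext => phi; apply/funext => w; rewrite mulrA.
- by move=> a x; apply/funext => phi; rewrite expr_actZ.
- apply/funext => phi; apply/funext => w.
  by rewrite -[w]cats0 gen_act_cat mul1r.
- by move=> u u' v w'; apply/funext => phi; rewrite gen_act_tail_l.
- by move=> u v w w'; apply/funext => phi; rewrite gen_act_tail_r.
- move=> u u' w w' u'w wu'; apply/funext => phi.
  by rewrite gen_act_tail_none //; apply/funext => x; rewrite mul0r.
Qed.

Definition deep_act (x : deep F m) := expr_act (repr x).

Lemma deep_act_pi e : deep_act (\pi e) = expr_act e.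
Proof. exact/expr_act_eq/deep_reprP. Qed.

Lemma deep_act_dgen u v : deep_act (dgen F u v) = gen_act u v.
Proof. exact: deep_act_pi. Qed.

Lemma deep_act0 phi w : deep_act 0 phi w = 0.
Proof. by rewrite [deep_act _]deep_act_pi /= mul0r. Qed.

Lemma deep_act1 phi : deep_act 1 phi = phi.
Proof. by rewrite [deep_act _]deep_act_pi; apply/funext => w; rewrite /= mul1r. Qed.

Lemma deep_actD x y phi w :
  deep_act (x + y) phi w = deep_act x phi w + deep_act y phi w.
Proof. by rewrite [deep_act _]deep_act_pi. Qed.

Lemma deep_actM x y phi : deep_act (x * y) phi = deep_act x (deep_act y phi).
Proof. by rewrite [deep_act _]deep_act_pi. Qed.

Lemma deep_actZ a x phi w : deep_act (a *: x) phi w = a * deep_act x phi w.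
Proof. by rewrite deep_actM [deep_act _]deep_act_pi. Qed.

Lemma deep_component_ind k (P : deep F m -> Prop) :
  P 0 -> (forall x y, P x -> P y -> P (x + y)) ->
  (forall a x, P x -> P (a *: x)) ->
  (forall u v, deep_deg (u, v) = k -> P (dgen F u v)) ->
  forall x, x \in @deep_component F m k -> P x.
Proof.
move=> P0 PD PZ Pd x /deep_component_span[s /allP sk ->].
rewrite big_seq; elim/big_rec: _ => // -[a [u v]] y /sk /eqP/= uv Py.
by apply: PD => //; apply/PZ/Pd.
Qed.

(** * Words as matrix indices, and the matrices at each level *)

(* Indices of level [n] are identified with words of length [n] along the     *)
(* block structure of [diag_emb]: the first letter is the block number.       *)
Fixpoint index_word n : 'I_(m ^ n) -> word m :=
  match n with
  | 0 => fun=> [::]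
  | n'.+1 => fun i =>
      let i' := cast_ord (esym (sum_expn m n')) i in
      tagnat.sig1 i' :: index_word (tagnat.sig2 i')
  end.

Lemma size_index_word n (i : 'I_(m ^ n)) : size (index_word i) = n.
Proof. by elim: n i => //= n IH i; rewrite IH. Qed.

Lemma index_word_inj n : injective (@index_word n).
Proof.
elim: n => [|n IH] i j /=; first by move=> _; apply/val_inj; case: i j => [[]// ?] [[]].
case=> e1 /IH e2; apply: (@cast_ord_inj _ _ (esym (sum_expn m n))).
by rewrite -[LHS]tagnat.sig2K -[RHS]tagnat.sig2K e2 e1.
Qed.

Lemma index_word_surj n w : size w = n -> exists i : 'I_(m ^ n), index_word i = w.
Proof.
elim: n w => [|n IH] [|c w] //= => [_|[/IH[i <-]]].
  by exists ord0.
exists (cast_ord (sum_expn m n) (tagnat.Rank c i)).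
by rewrite cast_ordK tagnat.Rank1K tagnat.Rank2K; congr (_ :: index_word _); apply/val_inj.
Qed.

Lemma diag_embE n (A : 'M[F]_(m ^ n)) (i j : 'I_(m ^ n.+1)) :
  let i' := cast_ord (esym (sum_expn m n)) i in
  let j' := cast_ord (esym (sum_expn m n)) j in
  diag_emb A i j =
  if tagnat.sig1 i' == tagnat.sig1 j' then A (tagnat.sig2 i') (tagnat.sig2 j')
  else 0.
Proof.
move=> i' j'; rewrite /diag_emb castmxE /= mxE -/i' -/j'.
by case: eqP => // e; rewrite ?conform_mx_id // mxE.
Qed.

Definition word_delta v : word m -> F := fun w => (w == v)%:R.

Definition deep_mx n (x : deep F m) : 'M[F]_(m ^ n) :=
  \matrix_(i, j) deep_act x (word_delta (index_word j)) (index_word i).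

Lemma deep_mx0 n : deep_mx n 0 = 0.
Proof. by apply/matrixP => i j; rewrite !mxE deep_act0. Qed.

Lemma deep_mx1 n : deep_mx n 1 = 1%:M.
Proof.
by apply/matrixP => i j; rewrite !mxE deep_act1 /word_delta (inj_eq (@index_word_inj n)).
Qed.

Lemma deep_mxD n x y : deep_mx n (x + y) = deep_mx n x + deep_mx n y.
Proof. by apply/matrixP => i j; rewrite !mxE deep_actD. Qed.

Lemma deep_mxZ n a x : deep_mx n (a *: x) = a *: deep_mx n x.
Proof. by apply/matrixP => i j; rewrite !mxE deep_actZ. Qed.

Lemma deep_mx_dgen n (i j : 'I_(m ^ n)) :
  deep_mx n (dgen F (index_word i) (index_word j)) = delta_mx i j.
Proof.
apply/matrixP => k l; rewrite !mxE deep_act_dgen.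
have [->|ki] := eqVneq k i.
  rewrite -[X in gen_act _ _ _ X]cat0s gen_act_cat /word_delta.
  by rewrite (inj_eq (@index_word_inj n)) eq_sym.
(* Between words of equal length, being a tail means equality. *)
rewrite gen_act_none // suffixE !size_index_word subnn drop0.
by rewrite (inj_eq (@index_word_inj n)).
Qed.

(* Elements of degree 0 preserve the length of words, so that their action at *)
(* words of length [n] depends only on the level [n] matrix.                  *)
Lemma deep_act_mx n x phi (i : 'I_(m ^ n)) : x \in @deep_component F m 0 ->
  deep_act x phi (index_word i) =
  \sum_j deep_mx n x i j * phi (index_word j).
Proof.
move: x; apply: deep_component_ind => [|x y IHx IHy|a x IHx|u v uv].
- by rewrite deep_act0 big1 // => j _; rewrite mxE deep_act0 mul0r.
- rewrite deep_actD IHx IHy -big_split; apply: eq_bigr => j _.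
  by rewrite !mxE deep_actD mulrDl.
- rewrite deep_actZ IHx mulr_sumr; apply: eq_bigr => j _.
  by rewrite !mxE deep_actZ mulrA.
move/eqP: uv; rewrite subr_eq0 /= => /eqP[uv].
rewrite deep_act_dgen; have [/suffixP[y iE]|Ni] := boolP (suffix u (index_word i)).
  (* Since [u] and [v] have equal length, [y ++ v] indexes a column, the only one with a nonzero
     entry in row [i]. *)
  have [|k kE] := @index_word_surj n (y ++ v).
    by rewrite -(size_index_word i) iE !size_cat uv.
  rewrite (bigD1 k) //= big1 ?addr0 => [|j jk].
    by rewrite mxE deep_act_dgen iE !gen_act_cat -kE /word_delta eqxx mul1r.
  rewrite mxE deep_act_dgen iE gen_act_cat -kE /word_delta.
  by rewrite (inj_eq (@index_word_inj n)) eq_sym (negPf jk) mul0r.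
rewrite gen_act_none // big1 // => j _.
by rewrite mxE deep_act_dgen gen_act_none ?mul0r.
Qed.

(** Only the left factor has to be balanced: [x] then sees [y] applied to a delta function only at
    words of length [n]. *)
Lemma deep_mxM n x y : x \in @deep_component F m 0 ->
  deep_mx n (x * y) = deep_mx n x *m deep_mx n y.
Proof.
move=> x0; apply/matrixP => i j; rewrite !mxE deep_actM deep_act_mx //.
by apply: eq_bigr => k _; rewrite [deep_mx n y k j]mxE.
Qed.

(** * Stabilization and the map to the direct limit *)

Definition stable_from n x :=
  forall k, (n <= k)%N -> deep_mx k.+1 x = diag_emb (deep_mx k x).

Lemma stable_fromW n n' x : (n <= n')%N -> stable_from n x -> stable_from n' x.
Proof. by move=> nn' xn k n'k; apply/xn/(leq_trans nn'). Qed.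

Lemma stable_from0 n : stable_from n 0.
Proof. by move=> k _; rewrite !deep_mx0 diag_emb0. Qed.

Lemma stable_fromD n x y :
  stable_from n x -> stable_from n y -> stable_from n (x + y).
Proof. by move=> xn yn k nk; rewrite !deep_mxD diag_embD xn ?yn. Qed.

Lemma stable_fromZ n a x : stable_from n x -> stable_from n (a *: x).
Proof. by move=> xn k nk; rewrite !deep_mxZ diag_embZ xn. Qed.

(** In a word of length k + 1 > n the first letter lies outside the tail being replaced, so it is
    preserved: entries between different blocks vanish and each diagonal block is the level k
    matrix. *)
Lemma stable_from_dgen n u v : size u = n -> size v = n ->
  stable_from n (dgen F u v).
Proof.
move=> un vn k nk; apply/matrixP => i j; rewrite diag_embE !mxE !deep_act_dgen /=.
set c := tagnat.sig1 (cast_ord _ i); set d := tagnat.sig1 (cast_ord _ j).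
set i' := tagnat.sig2 (cast_ord _ i); set j' := tagnat.sig2 (cast_ord _ j).
have [/suffixP[y iE]|Ni] := boolP (suffix u (index_word i')).
  rewrite iE -cat_cons !gen_act_cat /word_delta cat_cons eqseq_cons.
  by case: eqP.
rewrite !gen_act_none ?if_same //.
(* As n <= k, comparing tails of length n always drops the new first letter. *)
rewrite suffixE /= subSn ?suffixE ?size_index_word ?un //=.
by move: Ni; rewrite suffixE size_index_word un.
Qed.

Lemma stable_exists x : x \in @deep_component F m 0 -> exists n, stable_from n x.
Proof.
move: x; apply: deep_component_ind => [|x y [n xn] [k yk]|a x [n xn]|u v uv].
- by exists 0%N; apply: stable_from0.
- exists (maxn n k); apply: stable_fromD.
    exact: stable_fromW (leq_maxl _ _) xn.
  exact: stable_fromW (leq_maxr _ _) yk.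
- by exists n; apply: stable_fromZ.
move/eqP: uv; rewrite subr_eq0 /= => /eqP[uv].
by exists (size u); apply: stable_from_dgen.
Qed.

Lemma supernatural_mx_of_stable n k x : stable_from n x -> (n <= k)%N ->
  supernatural_mx_of (deep_mx k x) = supernatural_mx_of (deep_mx n x).
Proof.
move=> xn /subnK<-; elim: (k - n)%N => //= j <-.
by rewrite addSn xn ?leq_addl // supernatural_mx_of_emb.
Qed.

Lemma eventual_class (x : balanced_deep F m) : exists y : supernatural_mx F m,
  exists n, forall k, (n <= k)%N -> supernatural_mx_of (deep_mx k (val x)) = y.
Proof.
have [n xn] := stable_exists (valP x).
by exists (supernatural_mx_of (deep_mx n (val x))), n => k; apply: supernatural_mx_of_stable.
Qed.

(** The chosen value is forced, being the eventual one; identities can thus be checked at any large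
    enough level. *)
Definition balanced_map : balanced_deep F m -> supernatural_mx F m :=
  projT1 (choice eventual_class).

Lemma balanced_mapP x : exists n, forall k, (n <= k)%N ->
  balanced_map x = supernatural_mx_of (deep_mx k (val x)).
Proof.
have [n xn] := projT2 (choice eventual_class) x.
by exists n => k /xn.
Qed.

Lemma balanced_mapP2 x y : exists n, forall k, (n <= k)%N ->
  balanced_map x = supernatural_mx_of (deep_mx k (val x)) /\
  balanced_map y = supernatural_mx_of (deep_mx k (val y)).
Proof.
have [[n xn] [k yk]] := (balanced_mapP x, balanced_mapP y).
by exists (maxn n k) => l; rewrite geq_max => /andP[/xn ? /yk].
Qed.

End Action.

(** * Homomorphism, linearity and surjectivity *)

Theorem proposition4p1 (F : fieldType) (m : nat) :
  exists f : {rmorphism balanced_deep F m -> supernatural_mx F m},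
    scalable f /\ (forall y : supernatural_mx F m, exists x, f x = y).
Proof.
pose g := @balanced_map F m.
have gB : zmod_morphism g.
  move=> x y; have [n] := balanced_mapP2 x y.
  (* Level [l] is large enough for [x], [y] and their difference at once. *)
  have [k] := balanced_mapP (x - y); set l := maxn n k.
  move=> /(_ l (leq_maxr _ _)) exy /(_ l (leq_maxl _ _)) [ex ey].
  rewrite /g exy ex ey -scaleN1r.
  have -> : val (x + -1 *: y) = val x + -1 *: val y by [].
  rewrite deep_mxD deep_mxZ scaleN1r.
  by rewrite [- supernatural_mx_of _]supernatural_mx_ofN [RHS]supernatural_mx_ofD.
have gM : monoid_morphism g.
  split.
    have [n /(_ n (leqnn n))] := balanced_mapP (1 : balanced_deep F m).
    by rewrite /g => ->; rewrite deep_mx1 supernatural_mx_of1.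
  move=> x y; have [n] := balanced_mapP2 x y.
  have [k] := balanced_mapP (x * y); set l := maxn n k.
  move=> /(_ l (leq_maxr _ _)) exy /(_ l (leq_maxl _ _)) [ex ey].
  rewrite /g exy ex ey.
  by rewrite [RHS]supernatural_mx_ofM -deep_mxM ?(valP x).
pose gb := GRing.isZmodMorphism.Build _ _ g gB.
pose gm := GRing.isMonoidMorphism.Build _ _ g gM.
pose f : {rmorphism balanced_deep F m -> supernatural_mx F m} := HB.pack g gb gm.
exists f; split.
  move=> a x; have [n] := balanced_mapP2 x (a *: x).
  move=> /(_ n (leqnn n))[ex eax]; rewrite [f _]eax [f x]ex.
  have -> : val (a *: x) = a *: val x by [].
  by rewrite deep_mxZ [RHS]supernatural_mx_ofZ.
move=> y; have [t [B ->]] := supernatural_mx_common1 y.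
(* The preimage expands [B] in the matrix units of level [t]. *)
pose x : deep F m := \sum_i \sum_j B i j *: dgen F (index_word i) (index_word j).
have x0 : x \in @deep_component F m 0.
  apply: deep_component_sum => i _; apply: deep_component_sum => j _.
  apply/deep_componentZ/deep_component_d.
  by rewrite /deep_deg /= !size_index_word subrr.
(* The image of [x] is read at a possibly higher level; stability from [t] brings it back to [B]. *)
have xt : stable_from t x.
  apply: big_ind => [||i _]; [exact: stable_from0|exact: stable_fromD|].
  apply: big_ind => [||j _]; [exact: stable_from0|exact: stable_fromD|].
  by apply/stable_fromZ/stable_from_dgen; apply: size_index_word.
have xB : deep_mx t x = B.
  rewrite [RHS]matrix_sum_delta (big_morph _ (@deep_mxD F m t) (deep_mx0 _ _ _)).
  apply: eq_bigr => i _.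
  rewrite (big_morph _ (@deep_mxD F m t) (deep_mx0 _ _ _)).
  by apply: eq_bigr => j _; rewrite deep_mxZ deep_mx_dgen.
exists (BalancedDeep x0); have [n xn] := balanced_mapP (BalancedDeep x0).
rewrite [f _](xn (maxn n t)) ?leq_maxl //.
by rewrite (supernatural_mx_of_stable xt) ?leq_maxr // xB.
Qed.
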